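(* The sum $a+b$ and the product $ab$ of any two real numbers $a$ and $b$ (minimal rational Cauchy filters) are real numbers.
   Context: For $q\in\mathbb{Q}$ and rational $\varepsilon>0$ let $q_\varepsilon=\{x\in\mathbb{Q}\mid q-\varepsilon<x<q+\varepsilon\}$. A (rational) filter is a non-empty collection $\mathcal{F}$ of subsets of $\mathbb{Q}$ closed under binary intersections and under supersets (in $\mathbb{Q}$); the improper filter $\mathcal{P}(\mathbb{Q})$ is allowed as a filter. A filter $\mathcal{F}$ is Cauchy if for every rational $\varepsilon>0$ there is $q\in\mathbb{Q}$ with $q_\varepsilon\in\mathcal{F}$. A minimal Cauchy filter is a Cauchy filter $\mathcal{F}$ such that any Cauchy filter $\mathcal{G}\subseteq\mathcal{F}$ satisfies $\mathcal{G}=\mathcal{F}$. A real number here means a minimal Cauchy filter in $\mathbb{Q}$. For $A,B\subseteq\mathbb{Q}$ let $A+B=\{\alpha+\beta\mid\alpha\in A,\beta\in B\}$ and $AB=\{\alpha\beta\mid\alpha\in A,\beta\in B\}$. For real numbers $a,b$, the sum $a+b$ is the collection of all $C\subseteq\mathbb{Q}$ such that $C\supseteq A+B$ for some $A\in a$, $B\in b$; the product $ab$ is the collection of all $C\subseteq\mathbb{Q}$ such that $C\supseteq AB$ for some $A\in a$, $B\in b$. *)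

(* Defs.v *)
From mathcomp Require Import all_boot all_order all_algebra.
From mathcomp Require Import boolp classical_sets filter.

Set Implicit Arguments.
Unset Strict Implicit.
Unset Printing Implicit Defensive.

Import Order.TTheory GRing.Theory Num.Theory.

Local Open Scope classical_set_scope.
Local Open Scope ring_scope.

Definition rball (q eps : rat) : set rat := [set x | q - eps < x < q + eps].

(* [Filter] asks for [setT \in F] in place of non-emptiness, which amounts to
   the same by closure under supersets; it does not exclude the improper
   filter (that would be [ProperFilter]). *)
Definition cauchy_filter (F : set (set rat)) : Prop :=
  Filter F /\ forall eps : rat, 0 < eps -> exists q : rat, F (rball q eps).

Definition is_real (F : set (set rat)) : Prop :=
  cauchy_filter F /\
  forall G : set (set rat), cauchy_filter G -> G `<=` F -> G = F.

Definition set_add (A B : set rat) : set rat :=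
  [set x + y | x in A & y in B].

Definition set_mul (A B : set rat) : set rat :=
  [set x * y | x in A & y in B].

Definition real_add (a b : set (set rat)) : set (set rat) :=
  [set C | exists A B, [/\ a A, b B & set_add A B `<=` C]].

Definition real_mul (a b : set (set rat)) : set (set rat) :=
  [set C | exists A B, [/\ a A, b B & set_mul A B `<=` C]].

(* Main.v *)
Require Import Defs.
From mathcomp Require Import all_boot all_order all_algebra.
From mathcomp Require Import boolp classical_sets filter.
From mathcomp Require Import ring lra.

(** A Cauchy filter is minimal iff it is proper and round: every member
    contains a uniform [eps]-thickening of another member.  Sums and products
    inherit properness and the Cauchy property by the usual estimates.  A sum
    is round since thickening [A + B] amounts to thickening [A]; a product is
    round since multiplication of rationals is uniformly open: every rational
    at distance less than [e ^ 2 / 4] from [x * y] is a product of rationals at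
    distance less than [e] from [x] and [y]. *)

Set Implicit Arguments.
Unset Strict Implicit.
Unset Printing Implicit Defensive.

Import Order.TTheory GRing.Theory Num.Theory.

Local Open Scope classical_set_scope.
Local Open Scope ring_scope.

Definition thicken (A : set rat) (eps : rat) : set rat :=
  [set z | exists2 x, A x & `|z - x| < eps].

Definition round (F : set (set rat)) : Prop :=
  forall C, F C -> exists A eps, [/\ F A, 0 < eps & thicken A eps `<=` C].

Lemma rballE (q eps x : rat) : rball q eps x <-> `|x - q| < eps.
Proof. by rewrite /rball /= ltr_distl. Qed.

Lemma thicken_sub (A B : set rat) (d e : rat) :
  A `<=` B -> d <= e -> thicken A d `<=` thicken B e.
Proof.
by move=> AB de z [x Ax zx]; exists x; [exact: AB | exact: lt_le_trans zx de].
Qed.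

(** Let [C] contain the [eps]-thickening of [A] in [F]. A ball of radius [eps / 2] in [G] also
    belongs to [F], so by properness it meets [A]; all its points are then within [eps] of a point
    of [A], which puts the ball inside [C]. *)
Lemma round_proper_is_real (F : set (set rat)) :
  cauchy_filter F -> round F -> ~ F set0 -> is_real F.
Proof.
move=> cF rF F0; split=> // G [fG cG] GF.
apply/seteqP; split=> // C /rF[A [eps [FA eps0 AC]]].
have e20 : 0 < eps / 2 by lra.
have [q Gq] := cG _ e20; have fF := cF.1.
have [x [Ax qx]] : (A `&` rball q (eps / 2)) !=set0.
  apply/set0P/eqP => E; apply: F0; rewrite -E.
  by apply: filterI => //; exact: GF.
apply: filterS Gq => z qz; apply: AC; exists x => //.
move: qx qz; rewrite /rball /= => /andP[? ?] /andP[? ?].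
by rewrite ltr_distl; apply/andP; split; lra.
Qed.

(** An improper [F] contains every filter, in particular the neighbourhood filter [N] of 0, which is
    Cauchy but proper. This contradicts minimality. *)
Lemma is_real_proper (F : set (set rat)) : is_real F -> ~ F set0.
Proof.
move=> [[fF cF] mF] F0.
pose N : set (set rat) := [set C | exists2 e, 0 < e & rball 0 e `<=` C].
have N0 : N = F.
  apply: mF; last by move=> C _; apply: filterS F0.
  split; last by move=> e e0; exists 0; exists e.
  split; first by exists 1.
  - move=> P Q [d d0 dP] [e e0 eQ]; exists (Num.min d e).
      by rewrite lt_min d0.
    by move=> x /rballE; rewrite lt_min => /andP[/rballE/dP ? /rballE/eQ].
  - by move=> P Q PQ [d d0 dP]; exists d => // x /dP/PQ.
move: F0; rewrite -N0 => -[e e0 /(_ 0)]; apply.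
by apply/rballE; rewrite subrr normr0.
Qed.

(** The sets containing a thickening of a member of [F] form a Cauchy filter [G] inside [F], so
    minimality forces [G = F]. *)
Lemma is_real_round (F : set (set rat)) : is_real F -> round F.
Proof.
move=> [[fF cF] mF].
pose G : set (set rat) :=
  [set C | exists A eps, [/\ F A, 0 < eps & thicken A eps `<=` C]].
suff GF : G = F by move=> C; rewrite -{1}GF.
apply: mF; last first.
  move=> C [A [eps [FA eps0 AC]]]; apply: filterS FA => x Ax.
  by apply: AC; exists x => //; rewrite subrr normr0.
split; first split.
- by exists setT, 1; split=> //; exact: filterT.
- move=> P Q [A [d [FA d0 AP]]] [B [e [FB e0 BQ]]].
  exists (A `&` B), (Num.min d e); split; first exact: filterI.
    by rewrite lt_min d0.
  move=> z zAB; split.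
    by apply: AP; apply: thicken_sub zAB => [x []//|]; rewrite ge_min lexx.
  by apply: BQ; apply: thicken_sub zAB => [x []//|]; rewrite ge_min lexx orbT.
- by move=> P Q PQ [A [d [FA d0 AP]]]; exists A, d; split=> // x /AP/PQ.
- move=> e e0; have e20 : 0 < e / 2 by lra.
  have [q Fq] := cF _ e20; exists q, (rball q (e / 2)), (e / 2); split=> //.
  move=> z [x /andP[? ?]]; rewrite ltr_distl => /andP[? ?].
  by apply/andP; split; lra.
Qed.

Lemma real_filter_nonempty (a : set (set rat)) (A : set rat) :
  is_real a -> a A -> A !=set0.
Proof.
by move=> /is_real_proper a0 aA; apply/set0P/eqP => A0; apply: a0; rewrite -A0.
Qed.

Lemma real_add_filter (a b : set (set rat)) :
  Filter a -> Filter b -> Filter (real_add a b).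
Proof.
move=> fa fb; split.
- by exists setT, setT; split=> //; exact: filterT.
- move=> P Q [A [B [aA bB ABP]]] [A' [B' [aA' bB' ABQ]]].
  exists (A `&` A'), (B `&` B'); split; try exact: filterI.
  move=> _ [x [Ax A'x] [y [By B'y] <-]].
  by split; [apply: ABP | apply: ABQ]; exists x => //; exists y.
- by move=> P Q PQ [A [B [aA bB ABP]]]; exists A, B; split=> // x /ABP/PQ.
Qed.

Lemma real_mul_filter (a b : set (set rat)) :
  Filter a -> Filter b -> Filter (real_mul a b).
Proof.
move=> fa fb; split.
- by exists setT, setT; split=> //; exact: filterT.
- move=> P Q [A [B [aA bB ABP]]] [A' [B' [aA' bB' ABQ]]].
  exists (A `&` A'), (B `&` B'); split; try exact: filterI.
  move=> _ [x [Ax A'x] [y [By B'y] <-]].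
  by split; [apply: ABP | apply: ABQ]; exists x => //; exists y.
- by move=> P Q PQ [A [B [aA bB ABP]]]; exists A, B; split=> // x /ABP/PQ.
Qed.

Lemma real_add_proper (a b : set (set rat)) :
  is_real a -> is_real b -> ~ real_add a b set0.
Proof.
move=> ha hb [A [B [aA bB AB0]]].
have [x Ax] := real_filter_nonempty ha aA.
have [y By] := real_filter_nonempty hb bB.
by apply: (AB0 (x + y)); exists x => //; exists y.
Qed.

Lemma real_mul_proper (a b : set (set rat)) :
  is_real a -> is_real b -> ~ real_mul a b set0.
Proof.
move=> ha hb [A [B [aA bB AB0]]].
have [x Ax] := real_filter_nonempty ha aA.
have [y By] := real_filter_nonempty hb bB.
by apply: (AB0 (x * y)); exists x => //; exists y.
Qed.

Lemma real_add_cauchy (a b : set (set rat)) :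
  cauchy_filter a -> cauchy_filter b -> cauchy_filter (real_add a b).
Proof.
move=> [fa ca] [fb cb]; split; first exact: real_add_filter.
move=> e e0; have e20 : 0 < e / 2 by lra.
have [q aq] := ca _ e20; have [r br] := cb _ e20.
exists (q + r), (rball q (e / 2)), (rball r (e / 2)); split=> //.
move=> _ [x /andP[? ?] [y /andP[? ?] <-]].
by apply/andP; split; lra.
Qed.

Lemma real_mul_cauchy (a b : set (set rat)) :
  is_real a -> is_real b -> cauchy_filter (real_mul a b).
Proof.
move=> ha hb; have [[fa ca] _] := ha; have [[fb cb] _] := hb.
split; first exact: real_mul_filter.
move=> e e0.
have [q aq] := ca 1 ltr01; have [r br] := cb 1 ltr01.
pose M := `|q| + `|r| + 1.
have M0 : 0 < M by rewrite /M; have := normr_ge0 q; have := normr_ge0 r; lra.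
(* The final estimate has two terms, each a factor below [M] times a difference below [2 * d]. *)
pose d := e / (4 * M).
have d0 : 0 < d by rewrite divr_gt0// mulr_gt0.
have dM : e = 4 * M * d by rewrite /d mulrC divfK// mulf_neq0// gt_eqF.
have [q' aq'] := ca _ d0; have [r' br'] := cb _ d0.
have aA := @filterI _ _ fa _ _ aq aq'; have bB := @filterI _ _ fb _ _ br br'.
have [x0 [qx0 q'x0]] := real_filter_nonempty ha aA.
have [y0 [ry0 r'y0]] := real_filter_nonempty hb bB.
(* The centre is a product of points of the intersections, not [q' * r']: this way the bound [M]
   coming from the unit balls also applies to [y0]. *)
exists (x0 * y0); exists (rball q 1 `&` rball q' d), (rball r 1 `&` rball r' d).
split=> // _ [x [qx q'x] [y [ry r'y] <-]].
have close u v p : rball p d u -> rball p d v -> `|u - v| < 2 * d.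
  by move=> /andP[? ?] /andP[? ?]; rewrite ltr_distl; apply/andP; split; lra.
have xM : `|x| < M.
  move/rballE: qx => qx; have := ler_normD (x - q) q; rewrite subrK.
  by rewrite /M; have := normr_ge0 r; lra.
have yM : `|y0| < M.
  move/rballE: ry0 => ry0; have := ler_normD (y0 - r) r; rewrite subrK.
  by rewrite /M; have := normr_ge0 q; lra.
apply/rballE.
have -> : x * y - x0 * y0 = x * (y - y0) + (x - x0) * y0 by ring.
apply: (le_lt_trans (ler_normD _ _)); rewrite !normrM.
have -> : e = M * (2 * d) + (2 * d) * M by rewrite dM; ring.
by apply: ltrD; apply: ltr_pM => //; [exact: close r'y r'y0 | exact: close q'x q'x0].
Qed.

Lemma real_add_round (a b : set (set rat)) : round a -> round (real_add a b).
Proof.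
move=> ra C [A [B [aA bB ABC]]].
have [A' [e [aA' e0 A'A]]] := ra _ aA.
exists (set_add A' B), e; split=> //; first by exists A', B; split.
move=> z [_ [x A'x [y By <-]] zxy]; apply: ABC.
exists (z - y); last by exists y => //; rewrite subrK.
by apply: A'A; exists x => //; rewrite -addrA -opprD [y + x]addrC.
Qed.

Lemma mul_uniformly_open (x y z e : rat) : 0 < e ->
  `|z - x * y| < e ^+ 2 / 4 ->
  exists x' y', [/\ `|x' - x| < e, `|y' - y| < e & x' * y' = z].
Proof.
move=> e0 zxy.
(* A factor of size at least [e / 2] can be kept fixed while the other is found by division. The
   bound [e ^+ 2 / 2], twice the given one, leaves room for the last case, where shifting [y] by [u]
   adds an error [x * u] below [e ^+ 2 / 4]. *)
have cancel_large u v : e / 2 <= `|v| -> `|u| < e ^+ 2 / 2 -> `|u / v| < e.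
  move=> v_ge u_lt; have v0 : 0 < `|v| by lra.
  by rewrite normrM normfV ltr_pdivrMr//; nra.
have zxy2 : `|z - x * y| < e ^+ 2 / 2 by nra.
have [y_ge|y_lt] := leP (e / 2) `|y|.
  have y0 : y != 0 by rewrite -normr_gt0; lra.
  exists (z / y), y; split; last by rewrite divfK.
    by rewrite -[x in _ - x](mulfK y0) -mulrBl; exact: cancel_large.
  by rewrite subrr normr0.
have [x_ge|x_lt] := leP (e / 2) `|x|.
  have x0 : x != 0 by rewrite -normr_gt0; lra.
  exists x, (z / x); split; last by rewrite mulrC divfK.
    by rewrite subrr normr0.
  rewrite -[y in _ - y](mulKf x0) [x^-1 * _]mulrC -mulrBl.
  exact: cancel_large.
(* Both factors are small: push [y] away from [0] by [e / 2]. *)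
have [u uE yu] : exists2 u : rat, `|u| = e / 2 & e / 2 <= `|y + u|.
  (* Choosing [u] with the sign of [y] prevents cancellation in [y + u]. *)
  have [y0|y0] := leP 0 y.
    by exists (e / 2); rewrite ger0_norm; lra.
  by exists (- (e / 2)); [rewrite normrN ger0_norm | rewrite ler0_norm]; lra.
have yu0 : y + u != 0 by rewrite -normr_gt0; lra.
exists (z / (y + u)), (y + u); split; last by rewrite divfK.
  rewrite -[x in _ - x](mulfK yu0) -mulrBl; apply: cancel_large => //.
  have -> : z - x * (y + u) = (z - x * y) - x * u by ring.
  by apply: (le_lt_trans (ler_normB _ _)); rewrite normrM uE; nra.
by rewrite addrC addKr uE; lra.
Qed.

Lemma real_mul_round (a b : set (set rat)) :
  round a -> round b -> round (real_mul a b).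
Proof.
move=> ra rb C [A [B [aA bB ABC]]].
have [A' [d [aA' d0 A'A]]] := ra _ aA.
have [B' [e [bB' e0 B'B]]] := rb _ bB.
(* [mul_uniformly_open] moves both factors by the same radius, so it must suit [A'] and [B']
   alike. *)
pose m := Num.min d e; have m0 : 0 < m by rewrite lt_min d0.
exists (set_mul A' B'), (m ^+ 2 / 4); split; first by exists A', B'; split.
  by rewrite divr_gt0// exprn_gt0.
move=> z [_ [x A'x [y B'y <-]] /(mul_uniformly_open m0)[x' [y' [xx' yy' <-]]]].
apply: ABC; exists x'; last exists y' => //.
  by apply: A'A; exists x => //; apply: lt_le_trans xx' _; rewrite ge_min lexx.
by apply: B'B; exists y => //; apply: lt_le_trans yy' _; rewrite ge_min lexx orbT.
Qed.

Theorem lemma4p22 (a b : set (set rat)) (ha : is_real a) (hb : is_real b) :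
  is_real (real_add a b) /\ is_real (real_mul a b).
Proof.
split; apply: round_proper_is_real.
- exact: real_add_cauchy ha.1 hb.1.
- exact: real_add_round (is_real_round ha).
- exact: real_add_proper.
- exact: real_mul_cauchy.
- exact: real_mul_round (is_real_round ha) (is_real_round hb).
- exact: real_mul_proper.
Qed.
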